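(* Let $C=(C_{ij})_{1\le i,j\le d}$ be a connected Cartan matrix, fix an acyclic orientation of its simple graph, and let $(a(j,n))_{n\in\mathbf N}$, $j=1,\dots,d$, be the sequences of the associated frise. Suppose that the frise is rational, i.e. every sequence $(a(j,n))_{n\in\mathbf N}$ satisfies a linear recurrence. If all the sequences are bounded, then $C$ is of Dynkin type. If they are not all bounded, then $C$ is of Euclidean (affine) type.
   Context: A Cartan matrix is a $d\times d$ integer matrix $C$ with $C_{ii}=2$, $C_{ij}\le 0$ for $i\ne j$, and $C_{ij}\neq0\iff C_{ji}\ne 0$. Its simple graph has vertices $1,\dots,d$ and an undirected edge $\{i,j\}$ whenever $i\ne j$ and $C_{ij}\ne0$; $C$ is connected if this graph is connected. Given an acyclic orientation of this graph (write $i\to j$ if the edge $\{i,j\}$ is oriented from $i$ to $j$), the frise is the family of sequences $a(j,n)$, $j=1,\dots,d$, $n\in\mathbf N$, defined by $a(j,0)=1$ and $$a(j,n)\,a(j,n+1)=1+\Big(\prod_{j\to i}a(i,n)^{|C_{ij}|}\Big)\Big(\prod_{i\to j}a(i,n+1)^{|C_{ij}|}\Big);$$ acyclicity makes this well defined, and the values are positive rationals. A sequence $(a_n)$ of complex numbers satisfies a linear recurrence if there are $k\ge1$ and $\alpha_1,\dots,\alpha_k\in\mathbf C$ with $a_{n+k}=\alpha_1a_{n+k-1}+\dots+\alpha_ka_n$ for all $n$. Dynkin and Euclidean types refer to the standard classification of Cartan matrices (valued diagrams) of finite and affine type. *)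

(* Defs.v *)
From HB Require Import structures.
From mathcomp Require Import all_boot all_order all_algebra.
Set Implicit Arguments. Unset Strict Implicit. Unset Printing Implicit Defensive.
Import Order.TTheory GRing.Theory Num.Theory.
Local Open Scope ring_scope.

Definition is_cartan (d : nat) (C : 'M[int]_d) : Prop :=
  (forall i, C i i = 2) /\
  (forall i j, i != j -> C i j <= 0) /\
  (forall i j, (C i j != 0) = (C j i != 0)).

Definition cartan_graph (d : nat) (C : 'M[int]_d) : rel 'I_d :=
  fun i j => (i != j) && (C i j != 0).

Definition cartan_connected (d : nat) (C : 'M[int]_d) : Prop :=
  forall i j, connect (cartan_graph C) i j.

(* o i j means the edge {i,j} is oriented i -> j. *)
Definition is_orientation (d : nat) (C : 'M[int]_d) (o : rel 'I_d) : Prop :=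
  (forall i j, o i j -> cartan_graph C i j) /\
  (forall i j, cartan_graph C i j -> (o i j || o j i) && ~~ (o i j && o j i)).

Definition acyclic (d : nat) (o : rel 'I_d) : Prop :=
  forall i j, o i j -> ~~ connect o j i.

Definition is_frise (d : nat) (C : 'M[int]_d) (o : rel 'I_d)
  (a : 'I_d -> nat -> rat) : Prop :=
  (forall j, a j 0%N = 1) /\
  (forall j n, a j n * a j n.+1 =
     1 + (\prod_(i | o j i) a i n ^+ `|C i j|%N) *
         (\prod_(i | o i j) a i n.+1 ^+ `|C i j|%N)).

Definition has_linear_recurrence (F : nzRingType) (s : nat -> F) : Prop :=
  exists (k : nat) (alpha : 'I_k -> F), (0 < k)%N /\
    forall n, s (n + k)%N = \sum_(l < k) alpha l * s (n + k - 1 - l)%N.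

Definition cartan_rat (d : nat) (C : 'M[int]_d) : 'M[rat]_d :=
  map_mx (fun z : int => z%:~R) C.

(* Finite (Dynkin) type, Kac, Infinite-dim. Lie algebras, Thm 4.3 (Fin). *)
Definition finite_type (d : nat) (C : 'M[int]_d) : Prop :=
  let A := cartan_rat C in
  \det A != 0 /\
  (exists u : 'cV[rat]_d, (forall i, 0 < u i 0) /\ (forall i, 0 < (A *m u) i 0)) /\
  (forall v : 'cV[rat]_d, (forall i, 0 <= (A *m v) i 0) ->
      (forall i, 0 < v i 0) \/ v = 0).

(* Affine (Euclidean) type, Kac Thm 4.3 (Aff). *)
Definition affine_type (d : nat) (C : 'M[int]_d) : Prop :=
  let A := cartan_rat C in
  \rank A = d.-1 /\
  (exists u : 'cV[rat]_d, (forall i, 0 < u i 0) /\ A *m u = 0) /\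
  (forall v : 'cV[rat]_d, (forall i, 0 <= (A *m v) i 0) -> A *m v = 0).

(* Main.v *)
Require Import Defs.
From HB Require Import structures.
From mathcomp Require Import all_boot all_order all_algebra.
From Stdlib Require Import Classical_Prop.
From mathcomp Require Import zify ring lra.
Set Implicit Arguments. Unset Strict Implicit. Unset Printing Implicit Defensive.
Import Order.TTheory GRing.Theory Num.Theory.
Local Open Scope ring_scope.

(** The values of a frise are positive integers: modulo a(j,n+1), the two
    consecutive values a(i,n), a(i,n+1) (or a(i,n+1), a(i,n+2)) of a neighbour i
    are inverse to each other, which makes the next exchange relation at j
    divisible by a(j,n+1).  Moreover the vector a(.,n) determines a(.,n+1).

    If the frise is bounded, some vector repeats, say a(.,m) = a(.,m'); the
    products P_j of a(j,n) for m <= n < m' satisfy P_j^2 > prod_i P_i^|C_ij|, so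
    their logarithms form a nonnegative V with C^T V > 0, which forces C to be of
    finite type.

    If it is unbounded, no vector repeats, so there are finitely many n for which
    a(.,n) is below a given bound, and the sums S_j(N) of log a(j,n) for n < N
    grow faster than N.  Linear recurrence gives log a(j,n) = O(n), and summing
    the logarithms of the exchange relations gives C^T S(N) = O(N).  Pairing with
    S(N)/N shows that C v >= 0 implies C v = 0, which forces C to be affine. *)

(** * Irreducible matrices with nonpositive off-diagonal entries *)

Lemma connect_ind (T : finType) (e : rel T) (P : T -> Prop) :
  (forall x y, e x y -> P x -> P y) ->
  forall x y, connect e x y -> P x -> P y.
Proof.
move=> eP x y /connectP[p ep ->] {y}.
elim: p x ep => [|z p IHp] x //= /andP[exz ep] Px.
by apply: IHp ep _; apply: eP exz Px.
Qed.

Section IrreducibleZMatrix.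

Variables (R : realFieldType) (d : nat) (A : 'M[R]_d).
Hypothesis Aoff : forall i j, i != j -> A i j <= 0.
Hypothesis Adiag : forall i, 0 <= A i i.
Hypothesis Airr : forall i j, connect [rel i j | (i != j) && (A i j != 0)] i j.

(** At a zero of [v], every term of that row of [A v] is nonpositive while the row sum is
    nonnegative, so each term vanishes; zeros thus spread along edges to every vertex. *)
Lemma nonneg_supersolution_eq0 (v : 'cV[R]_d) (i0 : 'I_d) :
  (forall i, 0 <= v i 0) -> (forall i, 0 <= (A *m v) i 0) -> v i0 0 = 0 -> v = 0.
Proof.
move=> v0 Av0 vi0; apply/colP=> j; rewrite mxE.
pose P k := v k 0 = 0; apply: (connect_ind (P := P) _ (Airr i0 j) vi0) => {j}.
move=> x y /= /andP[nxy Axy] vx0; rewrite /P in vx0 *.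
have terms k : A x k * v k 0 <= 0.
  have [<-|nxk] := eqVneq x k; first by rewrite vx0 mulr0.
  by apply: mulr_le0_ge0 => //; apply: Aoff.
have := Av0 x; rewrite mxE (bigD1 y) //= => sum_ge0.
have rest : \sum_(k < d | k != y) A x k * v k 0 <= 0 by apply: sumr_le0.
have /eqP : A x y * v y 0 = 0 by have := terms y; lra.
by rewrite mulf_eq0 (negPf Axy) => /eqP.
Qed.

(** The pairing with [V] makes [A] monotone: [A v >= 0] gives [v >= 0]. Applied to both signs of a
    kernel vector, this gives [det A != 0], and [u] is the solution of [A u = 1]. Strict positivity
    comes from the spreading of zeros. *)
Lemma pairing_gt0_finite (V : 'rV[R]_d) :
  (forall i, 0 <= V 0 i) -> (forall j, 0 < (V *m A) 0 j) ->
  [/\ \det A != 0,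
      exists u : 'cV[R]_d, (forall i, 0 < u i 0) /\ (forall i, 0 < (A *m u) i 0)
    & forall v : 'cV[R]_d, (forall i, 0 <= (A *m v) i 0) ->
        (forall i, 0 < v i 0) \/ v = 0].
Proof.
move=> V0 VA0.
have nneg (v : 'cV[R]_d) : (forall i, 0 <= (A *m v) i 0) -> forall i, 0 <= v i 0.
  move=> Av0.
  (* The negative part w of v satisfies A w <= 0; pair it with V. *)
  pose w : 'cV[R]_d := \col_i Num.max (- v i 0) 0.
  have w0 i : 0 <= w i 0 by rewrite mxE le_max lexx orbT.
  have vw i : - v i 0 <= w i 0 by rewrite mxE le_max lexx.
  have Aw i : (A *m w) i 0 <= 0.
    have [vi|vi] := leP 0 (v i 0).
      rewrite mxE; apply: sumr_le0 => j _.
      have [<-|nij] := eqVneq i j.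
        by rewrite mxE max_r ?mulr0 // oppr_le0.
      by apply: mulr_le0_ge0 => //; apply: Aoff.
    suff: (A *m w) i 0 <= - (A *m v) i 0 by have := Av0 i; lra.
    rewrite !mxE -sumrN; apply: ler_sum => j _; rewrite -mulrN.
    have [<-|nij] := eqVneq i j; first by rewrite mxE max_l // oppr_ge0 ltW.
    by apply: ler_wnM2l (vw j); apply: Aoff.
  have le0 : (V *m (A *m w)) 0 0 <= 0.
    by rewrite mxE; apply: sumr_le0 => i _; apply: mulr_ge0_le0.
  move=> i; rewrite leNgt; apply/negP=> vi.
  have wi : 0 < w i 0 by apply: lt_le_trans (vw i); rewrite oppr_gt0.
  move: le0; rewrite mulmxA mxE leNgt => /negP; apply.
  rewrite (bigD1 i) //=; apply: ltr_wpDr; last exact: mulr_gt0.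
  by apply: sumr_ge0 => j _; apply: mulr_ge0 => //; apply: ltW.
have posv (v : 'cV[R]_d) : (forall i, 0 <= (A *m v) i 0) -> (forall i, 0 < v i 0) \/ v = 0.
  move=> Av0; have v0 := nneg v Av0.
  have [/forallP v_gt0|/forallPn[i]] := boolP [forall i, 0 < v i 0]; first by left.
  rewrite -leNgt => vi; right; apply: (@nonneg_supersolution_eq0 _ i) => //.
  by apply/eqP; rewrite eq_le vi v0.
have detA : \det A != 0.
  rewrite -det_tr; apply/det0P => -[w nzw wA]; case/eqP: nzw.
  have Aw : A *m w^T = 0 by rewrite -[A]trmxK -trmx_mul wA trmx0.
  apply/rowP=> i; apply/eqP; rewrite mxE eq_le -oppr_ge0.
  have := nneg w^T; rewrite Aw => /(_ _ i); rewrite mxE => -> //; last first.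
    by move=> k; rewrite mxE.
  have := nneg (- w^T); rewrite mulmxN Aw oppr0 => /(_ _ i).
  by rewrite !mxE => -> // k; rewrite mxE.
split=> //.
pose one : 'cV[R]_d := const_mx 1.
pose u := invmx A *m one.
have Au : A *m u = one by rewrite mulmxA mulmxV ?mul1mx // unitmxE unitfE.
have Au1 i : (A *m u) i 0 = 1 by rewrite Au mxE.
exists u; split=> [|i]; last by rewrite Au1.
have /posv[//|u0 i] : forall i, 0 <= (A *m u) i 0 by move=> i; rewrite Au1.
by move: (Au1 i); rewrite u0 mulmx0 mxE => /eqP; rewrite eq_sym oner_eq0.
Qed.

(** These vectors [S] replace a positive left null vector, which a limit of their rescalings would
    give over the reals; using them directly avoids limits. *)
Hypothesis almost_null : forall t : R, exists S : 'rV[R]_d,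
  [/\ forall i, 0 <= S 0 i, forall j, `|(S *m A) 0 j| <= 1 & exists i, t <= S 0 i].

(** A Harnack-type bound. In column [y] of [S A] only the diagonal term can be positive, so
    [S A >= -1] bounds [S x] by a multiple of [S y + 1] for each edge; these bounds compose along a
    path from [i] to [j]. *)
Lemma almost_null_comparable j : exists2 c : R, 0 <= c &
  forall S : 'rV[R]_d, (forall i, 0 <= S 0 i) ->
    (forall j, `|(S *m A) 0 j| <= 1) -> forall i, S 0 i <= c * (S 0 j + 1).
Proof.
pose bnd i y c := 0 <= c /\ forall S : 'rV[R]_d, (forall i, 0 <= S 0 i) ->
  (forall j, `|(S *m A) 0 j| <= 1) -> S 0 i <= c * (S 0 y + 1).
have step x y : (x != y) && (A x y != 0) -> exists c, bnd x y c.
  case/andP=> nxy Axy; have Axy_lt0 : A x y < 0 by rewrite lt_neqAle Axy Aoff.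
  exists ((A y y + 1) / - A x y); split.
    by rewrite divr_ge0 ?addr_ge0 // oppr_ge0 ltW.
  move=> S S0 /(_ y); rewrite ler_norml mxE (bigD1 x) //= (bigD1 y) 1?eq_sym //=.
  set rest := \sum_(_ < d | _) _.
  have rest0 : rest <= 0.
    by apply: sumr_le0 => k /andP[_ nky]; apply: mulr_ge0_le0 => //; apply: Aoff.
  case/andP=> lo _; rewrite mulrAC ler_pdivlMr ?oppr_gt0 //.
  have := S0 y; have := Adiag y; nra.
have ebnd i : exists c, bnd i j c.
  apply: (connect_ind (P := fun y => exists c, bnd i y c) _ (Airr i j)); last first.
    by exists 1; split=> // S S0 _; lra.
  move=> x y /step[c' [c'0 c'P]] [c [c0 cP]]; exists (c * (c' + 1)).
  split=> [|S S0 SA]; first by rewrite mulr_ge0 ?addr_ge0.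
  apply: le_trans (cP S S0 SA) _; rewrite -mulrA ler_wpM2l //.
  have := c'P S S0 SA; have := S0 y; nra.
have [c cP] := fin_all_exists ebnd.
exists (\sum_i c i) => [|S S0 SA i].
  by apply: sumr_ge0 => i _; case: (cP i).
have [ci0 /(_ S S0 SA) /le_trans-> //] := cP i.
apply: ler_wpM2r; first by rewrite addr_ge0.
by rewrite (bigD1 i) //= lerDl sumr_ge0 // => k _; case: (cP k).
Qed.

(** If [(A v)_j > 0], then [S (A v) = (S A) v <= sum |v_i|] limits [S j], hence by comparability all
    entries of [S], which can however be made arbitrarily large. *)
Lemma almost_null_supersolution (v : 'cV[R]_d) :
  (forall i, 0 <= (A *m v) i 0) -> A *m v = 0.
Proof.
move=> Av0; apply/colP=> j; rewrite [RHS]mxE; apply/eqP/negPn/negP=> Avj.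
have {Avj} Avj : 0 < (A *m v) j 0 by rewrite lt_neqAle eq_sym Avj Av0.
have [c c0 cP] := almost_null_comparable j.
pose B := \sum_i `|v i 0|.
have [S [S0 SA [i Si]]] := almost_null (c * (B / (A *m v) j 0 + 1) + 1).
have SAv : (S *m (A *m v)) 0 0 <= B.
  rewrite mulmxA mxE; apply: ler_sum => k _; apply: le_trans (ler_norm _) _.
  by rewrite normrM ler_piMl.
have Sj : S 0 j <= B / (A *m v) j 0.
  rewrite ler_pdivlMr //; apply: le_trans SAv.
by rewrite [leRHS]mxE (bigD1 j) //= lerDl sumr_ge0 // => k _; rewrite mulr_ge0.
have := le_trans Si (cP S S0 SA i); apply/negP; rewrite -ltNge.
by rewrite (le_lt_trans (y := c * (B / (A *m v) j 0 + 1))) ?ltrDl // ler_wpM2l // lerD2r.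
Qed.

(** The triangle inequality in each row of [A v = 0] gives [A |v| <= 0], so [-|v|] is a
    supersolution. *)
Lemma almost_null_kernel_norm (v : 'cV[R]_d) :
  A *m v = 0 -> A *m (\col_i `|v i 0|) = 0.
Proof.
move=> Av; apply: oppr_inj; rewrite oppr0 -mulmxN.
apply: almost_null_supersolution => i.
have := congr1 (fun M : 'cV[R]_d => M i 0) Av.
rewrite mxE [RHS]mxE (bigD1 i) //= => /eqP; rewrite addrC addr_eq0 => /eqP Avi.
rewrite mxE (bigD1 i) //= !mxE mulrN addrC subr_ge0.
have -> : A i i * `|v i 0| = `|\sum_(j < d | j != i) A i j * v j 0|.
  by rewrite Avi normrN normrM ger0_norm.
apply: le_trans (ler_norm_sum _ _ _) _; apply: ler_sum => j nji.
by rewrite normrM !mxE mulrN -mulNr ler0_norm // Aoff // eq_sym.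
Qed.

Lemma almost_null_affine :
  [/\ \rank A = d.-1,
      exists u : 'cV[R]_d, (forall i, 0 < u i 0) /\ A *m u = 0
    & forall v : 'cV[R]_d, (forall i, 0 <= (A *m v) i 0) -> A *m v = 0].
Proof.
have [S0 [_ _ [i0 _]]] := almost_null 0.
(* This makes the kernel one-dimensional in the end: a combination of two kernel vectors chosen to
   vanish at [i0] vanishes everywhere. *)
have zeroP (v : 'cV[R]_d) i : A *m v = 0 -> v i 0 = 0 -> v = 0.
  move=> /almost_null_kernel_norm Av vi.
  have nv0 : \col_i `|v i 0| = 0.
    apply: (@nonneg_supersolution_eq0 _ i) => [k|k|].
    - by rewrite mxE.
    - by rewrite Av mxE.
    - by rewrite mxE vi normr0.
  apply/colP=> k; have := congr1 (fun M : 'cV[R]_d => M k 0) nv0.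
  by rewrite !mxE => /normr0_eq0.
have detA : \det A = 0.
  apply/eqP/negPn/negP=> detA.
  have Aw : A *m (invmx A *m const_mx 1 : 'cV[R]_d) = const_mx 1.
    by rewrite mulmxA mulmxV ?mul1mx // unitmxE unitfE.
  have := @almost_null_supersolution (invmx A *m const_mx 1); rewrite Aw.
  have pos1 i : 0 <= (const_mx 1 : 'cV[R]_d) i 0 by rewrite mxE.
  move=> /(_ pos1)/(congr1 (fun M : 'cV[R]_d => M i0 0))/eqP.
  by rewrite !mxE oner_eq0.
have [u u0 Au] : exists2 u : 'cV[R]_d, (forall i, 0 < u i 0) & A *m u = 0.
  have /eqP/det0P[w nzw wA] : \det A^T = 0 by rewrite det_tr.
  have Aw : A *m w^T = 0 by rewrite -[A]trmxK -trmx_mul wA trmx0.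
  exists (\col_i `|w^T i 0|); last exact: almost_null_kernel_norm.
  move=> i; rewrite mxE normr_gt0; apply/eqP=> /(zeroP _ _ Aw) w0.
  by case/eqP: nzw; rewrite -[w]trmxK w0 trmx0.
split; [|by exists u|exact: almost_null_supersolution].
suff kerA : (kermx A^T == u^T)%MS.
  have := mxrank_ker A^T; rewrite (eqmxP kerA) (mxrank_tr A) => rk.
  have rku : \rank u^T = 1%N.
    rewrite rank_rV; case: eqP => // /(congr1 (fun M : 'rV[R]_d => M 0 i0)).
    by rewrite !mxE => ui; move: (u0 i0); rewrite ui ltxx.
  have := rank_leq_row A; move: rk; rewrite rku; lia.
apply/andP; split; last first.
  by apply/sub_kermxP; rewrite -trmx_mul Au trmx0.
apply/row_subP=> k; move: (row k _) (row_sub k (kermx A^T)) => w /sub_kermxP wA.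
have Aw : A *m w^T = 0 by rewrite -[A]trmxK -trmx_mul wA trmx0.
pose c := w 0 i0 / u i0 0.
have /(zeroP _ i0) wcu : A *m (w^T - c *: u) = 0.
  by rewrite mulmxBr Aw -scalemxAr Au scaler0 subr0.
have /eqP : w^T - c *: u = 0.
  apply: wcu; rewrite !mxE divfK; last by rewrite gt_eqF.
  by rewrite subrr.
rewrite subr_eq0 => /eqP /(congr1 trmx); rewrite trmxK linearZ /= => ->.
exact: scalemx_sub.
Qed.

End IrreducibleZMatrix.

(** * Linear recurrences *)

(** By excluded middle, either [n] is a maximum point or some value is larger, and moving there
    shrinks the gap [b - f n]. *)
Lemma bounded_nat_argmax (f : nat -> nat) (b : nat) :
  (forall n, f n <= b)%N -> exists n, forall m, (f m <= f n)%N.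
Proof.
move=> fb.
suff max_from g n : (b - f n <= g)%N -> exists m, forall k, (f k <= f m)%N.
  exact: (max_from b 0%N (leq_subr _ _)).
elim: g n => [|g IHg] n bg.
  by exists n => k; rewrite (leq_trans (fb k)) // -subn_eq0 -leqn0.
case: (classic (exists m, f n < f m)%N) => [[m fnm]|nm].
  by apply: (IHg m); have := fb m; lia.
by exists n => k; rewrite leqNgt; apply/negP=> fnk; apply: nm; exists k.
Qed.

(* The space of relations satisfied by the first N windows of s is cut out by a
   matrix over K; its dimension stabilizes as N grows, and solvability of a
   linear system does not depend on the field. *)
Lemma linear_recurrence_descent (K L : fieldType) (f : {rmorphism K -> L})
  (s : nat -> K) :
  has_linear_recurrence (fun n => f (s n)) -> has_linear_recurrence s.
Proof.
case=> k [alpha [k0 rec]].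
pose M N : 'M[K]_(k.+1, N) := \matrix_(l < k.+1, n < N) s (n + k - l)%N.
have [N maxN] := bounded_nat_argmax (fun N => rank_leq_row (M N)).
have kerM N' : (N <= N')%N -> (kermx (M N) <= kermx (M N'))%MS.
  move=> leNN'.
  have sub : (kermx (M N') <= kermx (M N))%MS.
    apply/sub_kermxP; have -> : M N = colsub (widen_ord leNN') (M N').
      by apply/matrixP=> l n; rewrite !mxE.
    by rewrite mulmx_colsub mulmx_ker; apply/matrixP=> l n; rewrite !mxE.
  have [_ <-] := mxrank_leqif_sup sub.
  rewrite eqn_leq mxrankS // !mxrank_ker leq_sub2l //; exact: maxN.
(* Over [L] the recurrence writes row 0 as a combination of the other rows; inclusion of row spaces
   is insensitive to field extension, so coefficients [D] exist in [K]. *)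
have /submxP[D rowD] : (row 0 (M N) <= row' 0 (M N))%MS.
  rewrite -(map_submx f); apply/submxP; exists (\row_l alpha l).
  apply/rowP=> n; rewrite !mxE subn0 rec; apply: eq_bigr => l _.
  by rewrite !mxE; congr (_ * f (s _)); rewrite /= /bump /=; lia.
pose beta : 'rV[K]_k.+1 := \row_l oapp (fun l' => - D 0 l') 1 (unlift 0 l).
have betaM N' (n : 'I_N') : (beta *m M N') 0 n =
    s (n + k)%N - \sum_l D 0 l * s (n + k - 1 - l)%N.
  rewrite mxE big_ord_recl !mxE unlift_none /= mul1r subn0 -sumrN.
  congr (_ + _); apply: eq_bigr => l _; rewrite !mxE liftK /= mulNr.
  by congr (- (_ * s _)); rewrite /bump /=; lia.
have beta_ker : (beta <= kermx (M N))%MS.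
  apply/sub_kermxP/rowP=> n; rewrite betaM [RHS]mxE.
  move/rowP/(_ n): rowD; rewrite !mxE subn0 => ->.
  apply/eqP; rewrite subr_eq0; apply/eqP; apply: eq_bigr => l _.
  by rewrite !mxE; congr (_ * s _); rewrite /= /bump /=; lia.
exists k, (D 0); split=> // n.
(* Window [n] has to be one of the columns, so the relation is carried from [N] to [maxn N n.+1]. *)
have lt_n : (n < maxn N n.+1)%N by rewrite leq_max ltnSn orbT.
have /sub_kermxP/rowP/(_ (Ordinal lt_n)) :=
  submx_trans beta_ker (kerM _ (leq_maxl N n.+1)).
by rewrite betaM mxE /= => /eqP; rewrite subr_eq0 => /eqP.
Qed.

Lemma linear_recurrence_le_exp (s : nat -> rat) : has_linear_recurrence s ->
  exists B : nat, forall n, `|s n| <= (B ^ n.+1)%:R.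
Proof.
case=> k [alpha [k0 rec]].
(* The first sum drives the inductive step, the second covers the initial values, and the final 1
   makes the powers of [b] nondecreasing. *)
pose b := \sum_l `|alpha l| + \sum_(n < k) `|s n| + 1.
have sa0 : 0 <= \sum_l `|alpha l| by apply: sumr_ge0.
have ss0 : 0 <= \sum_(n < k) `|s n| by apply: sumr_ge0.
have b1 : 1 <= b by rewrite /b; lra.
have b0 : 0 <= b by lra.
have sb n : `|s n| <= b ^+ n.+1.
  elim/ltn_ind: n => n IHn; have [nk|kn] := ltnP n k.
    apply: (@le_trans _ _ b); last by rewrite exprS ler_peMr ?exprn_ege1.
    have : `|s n| <= \sum_(m < k) `|s m|.
      by rewrite (bigD1 (Ordinal nk)) //= lerDl sumr_ge0.
    by rewrite /b; lra.
  rewrite -(subnK kn) rec; apply: le_trans (ler_norm_sum _ _ _) _.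
  apply: (@le_trans _ _ (\sum_l `|alpha l| * b ^+ n)).
    apply: ler_sum => l _; rewrite normrM ler_wpM2l //.
    have ltl := ltn_ord l.
    apply: le_trans (IHn _ _) _; first by lia.
    by apply: ler_weXn2l => //; lia.
  rewrite -mulr_suml subnK // exprS ler_wpM2r ?exprn_ge0 //.
  by rewrite /b; lra.
exists (Num.bound b) => n; apply: le_trans (sb n) _; rewrite natrX.
by apply: lerXn2r; rewrite ?nnegrE // ltW // archi_boundP.
Qed.

(** * Integrality of frises *)

(** Induction on the number of vertices from which [j] can be reached: passing back along an edge
    [i -> j] loses at least [j] itself. *)
Lemma acyclic_ind (d : nat) (o : rel 'I_d) (P : 'I_d -> Prop) : acyclic o ->
  (forall j, (forall i, o i j -> P i) -> P j) -> forall j, P j.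
Proof.
move=> ac step j; have [m] := ubnP #|[pred k | connect o k j]|.
elim: m j => // m IHm j ltj; apply: step => i oij; apply: IHm.
rewrite -ltnS (leq_trans _ ltj) // ltnS; apply/proper_card/properP; split.
  by apply/subsetP=> k; rewrite !inE => /connect_trans-> //; apply: connect1.
by exists j; rewrite !inE ?connect0 // ac.
Qed.

Lemma prod_eq1_mod (I : finType) (P : pred I) (x y : I -> nat) (c : I -> nat) m :
  (forall i, P i -> x i * y i = 1 %[mod m])%N ->
  ((\prod_(i | P i) x i ^ c i) * (\prod_(i | P i) y i ^ c i) = 1 %[mod m])%N.
Proof.
move=> xy; rewrite -big_split /=.
elim/big_rec: _ => // i z Pi z1; rewrite -expnMn -modnMm z1 modnMm muln1.
by rewrite -modnXm xy // modnXm exp1n.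
Qed.

Section Integrality.

Variables (d : nat) (C : 'M[int]_d) (o : rel 'I_d) (a : 'I_d -> nat -> rat).
Hypotheses (cartanC : is_cartan C) (oriC : is_orientation C o).
Hypotheses (acyc : acyclic o) (friseA : is_frise C o a).

(** Truncation supplies candidate integers before integrality is known; [good] records that it was
    exact and positive. *)
Let A j n := Num.trunc (a j n).
Let good j n := (0 < A j n)%N /\ a j n = (A j n)%:R.
Let rhs j n := (1 + (\prod_(i | o j i) A i n ^ `|C i j|) *
                    (\prod_(i | o i j) A i n.+1 ^ `|C i j|))%N.

Let goodI j n x : (0 < x)%N -> a j n = x%:R -> good j n.
Proof. by move=> x0 ajn; rewrite /good /A ajn natrK. Qed.

Let rhsE j n : (forall i, o j i -> good i n) -> (forall i, o i j -> good i n.+1) ->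
  a j n * a j n.+1 = (rhs j n)%:R.
Proof.
move=> gn gn1; case: friseA => _ ->; rewrite natrD natrM !natr_prod.
by congr (1 + _ * _); apply: eq_bigr => i oi;
  rewrite natrX; [have [_ <-] := gn i oi|have [_ <-] := gn1 i oi].
Qed.

Let edge_neq0 i j : o i j -> (0 < `|C i j|)%N /\ (0 < `|C j i|)%N.
Proof.
case: oriC => sub _ /sub /andP[_ nz].
by case: cartanC => _ [_ sym]; rewrite !absz_gt0 (sym j) nz.
Qed.

(* Modulo [A j n.+1] every neighbour i of j has mutually inverse values before
   and after its own step, since [A j n.+1] divides the product on the right. *)
Let dvd_rhs j n :
  (forall i, A i n * A i n.+1 = rhs i n)%N ->
  (forall i, o i j -> A i n.+1 * A i n.+2 = rhs i n.+1)%N ->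
  (A j n.+1 %| rhs j n.+1)%N.
Proof.
move=> recn recn1; set m := A j n.+1.
have add_dvd z : (m %| z -> 1 + z = 1 %[mod m])%N.
  by move=> /eqP mz; rewrite -modnDmr mz addn0.
have inv_out i : o j i -> (A i n * A i n.+1 = 1 %[mod m])%N.
  move=> oji; rewrite recn; apply: add_dvd.
  rewrite dvdn_mull // (bigD1 j) //= dvdn_mulr // dvdn_exp //.
  by case: (edge_neq0 oji).
have inv_in i : o i j -> (A i n.+1 * A i n.+2 = 1 %[mod m])%N.
  move=> oij; rewrite recn1 //; apply: add_dvd.
  rewrite dvdn_mulr // (bigD1 j) //= dvdn_mulr // dvdn_exp //.
  by case: (edge_neq0 oij).
have XX := prod_eq1_mod (fun i => `|C i j|%N) inv_out.
have YY := prod_eq1_mod (fun i => `|C i j|%N) inv_in.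
have dvdm : (m %| rhs j n)%N by rewrite -recn dvdn_mull.
move: XX YY dvdm; rewrite /rhs.
set X := (\prod_(i | o j i) A i n ^ _)%N; set X' := (\prod_(i | o j i) _)%N.
set Y := (\prod_(i | o i j) A i n.+1 ^ _)%N; set Y' := (\prod_(i | o i j) _)%N.
move=> XX YY dvdm; rewrite /dvdn -modnDml.
(* Modulo [m], replacing 1 by [X X' Y Y'] turns [1 + X' Y'] into [X' Y' (1 + X Y)], whose last
   factor is [A j n * A j n.+1]. *)
have {1}-> : (1 %% m = (X * X') * (Y * Y') %% m)%N.
  by rewrite -modnMm XX YY modnMm.
rewrite modnDml.
have -> : ((X * X') * (Y * Y') + X' * Y' = (X' * Y') * (1 + X * Y))%N by ring.
by rewrite -/(dvdn _ _) dvdn_mull.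
Qed.

(** Induction on time and, within each time, along the orientation. Time 1 needs no division because
    [a j 0 = 1]; later divisions are exact by [dvd_rhs]. *)
Lemma frise_integral : exists A : 'I_d -> nat -> nat,
  (forall j n, 0 < A j n)%N /\ (forall j n, a j n = (A j n)%:R).
Proof.
have good0 j : good j 0 by apply: (@goodI _ _ 1%N) => //; case: friseA.
have nat_rec j n : good j n -> good j n.+1 -> a j n * a j n.+1 = (rhs j n)%:R ->
    (A j n * A j n.+1 = rhs j n)%N.
  by move=> [_ ->] [_ ->] /eqP; rewrite -natrM eqr_nat => /eqP.
have good1 j : good j 1.
  apply: (acyclic_ind (P := fun j => good j 1) acyc) => {}j IHj.
  apply: (@goodI _ _ (rhs j 0)) => //.
  by rewrite -rhsE // (_ : a j 0 = 1) ?mul1r //; case: friseA.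
suff goodn n : forall j, good j n /\ good j n.+1.
  by exists A; split=> j n; case: (goodn n j) => -[].
elim: n => [|n IHn] j //; split; first by case: (IHn j).
have recn i : (A i n * A i n.+1 = rhs i n)%N.
  have [gn gn1] := IHn i; apply: nat_rec => //.
  by apply: rhsE => k _; case: (IHn k).
(* [P] also carries the integer relation, since [dvd_rhs] uses it at the vertices preceding [j]. *)
pose P j := good j n.+2 /\ (A j n.+1 * A j n.+2 = rhs j n.+1)%N.
suff [] : P j by [].
apply: (acyclic_ind (P := P) acyc) => {}j IHj.
have arec : a j n.+1 * a j n.+2 = (rhs j n.+1)%:R.
  by apply: rhsE => k ok; [case: (IHn k) | case: (IHj k ok)].
have [_ [A0 aA]] := IHn j.
have /dvdnP[q rhsq] : (A j n.+1 %| rhs j n.+1)%N.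
  by apply: dvd_rhs => // i oij; case: (IHj i oij).
have gj : good j n.+2.
  apply: (@goodI _ _ q); first by move: rhsq; rewrite /rhs; case: q.
  apply: (mulfI (x := a j n.+1)); first by rewrite aA pnatr_eq0 -lt0n.
  by rewrite arec rhsq natrM -aA mulrC.
by split=> //; apply: nat_rec => //; case: (IHn j).
Qed.

End Integrality.

(** * Growth of frises *)

Lemma ltn_prod_succ (m n : nat) (z : nat -> nat) : (m < n)%N ->
  (\prod_(m <= k < n) z k < \prod_(m <= k < n) (1 + z k))%N.
Proof.
move=> ltmn; rewrite [ltnLHS]big_ltn // [ltnRHS]big_ltn // mulnDl mul1n.
set p := bigop _ _ _; set q := bigop _ _ _.
have leqpq : (p <= q)%N by apply: leq_prod => k _; apply: leqnSn.
have q0 : (0 < q)%N by apply: prodn_gt0.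
by rewrite -add1n; apply: leq_add => //; apply: leq_mul.
Qed.

Lemma prod_expn (I : Type) (r : seq I) (x : I -> nat) c :
  (\prod_(k <- r) x k ^ c = (\prod_(k <- r) x k) ^ c)%N.
Proof. by rewrite (big_morph (expn^~ c) (fun x y => expnMn x y c) (exp1n c)). Qed.

(** Bernoulli's inequality [(1 + 1/y)^K >= 1 + K/y >= 2], cleared of denominators in [bern]. *)
Lemma leq_double_expn (y K : nat) : (0 < y <= K -> 2 * y ^ K <= y.+1 ^ K)%N.
Proof.
case/andP=> y0 leyK.
have bern k : (y ^ k * (y + k) <= y * y.+1 ^ k)%N.
  elim: k => [|k IHk]; first by rewrite !expn0 addn0 mul1n muln1.
  apply: (@leq_trans (y.+1 * (y ^ k * (y + k)))); rewrite !expnS; last first.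
    by rewrite [leqRHS]mulnCA leq_mul2l IHk orbT.
  rewrite [leqLHS]mulnAC [leqLHS]mulnC [leqRHS]mulnCA leq_mul2l.
  by apply/orP; right; rewrite mulSn mulnDr mulnS; lia.
rewrite -(leq_pmul2l y0); apply: leq_trans (bern K).
by rewrite mulnCA mulnA mulnC leq_mul2l mul2n -addnn leq_add2l leyK orbT.
Qed.

Lemma leq_expn2r (m n e : nat) : (m <= n -> m ^ e <= n ^ e)%N.
Proof. by case: e => [|e] lemn; rewrite ?expn0 // leq_exp2r. Qed.

(* Integer logarithms of high powers approximate the logarithms of P well enough
   to keep the strict inequalities. *)
Lemma log_subadditive (d : nat) (c : 'I_d -> 'I_d -> nat) (P : 'I_d -> nat) :
  (forall j, 0 < P j)%N -> (forall j, \prod_i P i ^ c i j < P j ^ 2)%N ->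
  exists L : 'I_d -> nat, forall j, (\sum_i c i j * L i < 2 * L j)%N.
Proof.
move=> P0 ltP; pose y j := (\prod_i P i ^ c i j)%N.
(* Since [y j + 1 <= P j ^ 2] and [y j <= Y], each [Y]-th power gains a factor 2. The exponent
   [3 * Y] thus gains [2^3], more than the [2^2] lost by rounding [L j] down. *)
pose Y := (\sum_j y j)%N; pose L i := trunc_log 2 (P i ^ (3 * Y)).
exists L => j; have yY : (y j <= Y)%N by rewrite /Y (bigD1 j) //= leq_addr.
have y0 : (0 < y j)%N by apply: prodn_gt0 => i; rewrite expn_gt0 P0.
have PL i : (2 ^ L i <= P i ^ (3 * Y) < 2 ^ (L i).+1)%N.
  by apply: trunc_log_bounds; rewrite // expn_gt0 P0.
have lo : (2 ^ (\sum_i c i j * L i) <= y j ^ (3 * Y))%N.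
  rewrite /y -prod_expn expn_sum; apply: leq_prod => i _.
  by rewrite expnAC mulnC expnM leq_expn2r //; case/andP: (PL i).
have mid : (2 ^ 3 * y j ^ (3 * Y) <= (P j ^ 2) ^ (3 * Y))%N.
  rewrite [(3 * Y)%N]mulnC !expnM -expnMn leq_expn2r //.
  have /leq_double_expn/leq_trans-> // : (0 < y j <= Y)%N by rewrite y0.
  exact/leq_expn2r/ltP.
have hi : ((P j ^ 2) ^ (3 * Y) < 2 ^ (2 * (L j).+1))%N.
  by rewrite expnAC [(2 * _.+1)%N]mulnC [(2 ^ _)%N]expnM ltn_exp2r //; case/andP: (PL j).
have : (2 ^ (3 + \sum_i c i j * L i) < 2 ^ (2 * (L j).+1))%N.
  by apply: leq_ltn_trans hi; apply: leq_trans mid; rewrite expnD leq_mul2l lo orbT.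
rewrite ltn_exp2l //; lia.
Qed.

Lemma big_neighbours (R : Type) (idx : R) (op : Monoid.com_law idx)
  (I : finType) (o : rel I) (j : I) (F : I -> R) :
  (forall i, ~~ (o i j && o j i)) ->
  (forall i, ~~ o j i -> ~~ o i j -> F i = idx) ->
  \big[op/idx]_i F i =
  op (\big[op/idx]_(i | o j i) F i) (\big[op/idx]_(i | o i j) F i).
Proof.
move=> asym F0; rewrite (bigID (o j)) /=; congr (op _ _).
rewrite (bigID (fun i => o i j)) /= [X in op _ X]big1 ?Monoid.mulm1.
  apply: eq_bigl => i; case: (boolP (o i j)) => oij; rewrite ?andbF // andbT.
  by have := asym i; rewrite oij.
by move=> i /andP[] /F0.
Qed.

Section NaturalFrise.

Variables (d : nat) (c : 'I_d -> 'I_d -> nat) (o : rel 'I_d).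
Variable A : 'I_d -> nat -> nat.
Hypothesis acyc : acyclic o.
Hypothesis asym : forall i j, ~~ (o i j && o j i).
Hypothesis c_supp : forall i j, ~~ o j i -> ~~ o i j -> c i j = 0%N.
Hypothesis A0 : forall j, A j 0%N = 1%N.
Hypothesis A_gt0 : forall j n, (0 < A j n)%N.

Definition exchange_product j n :=
  ((\prod_(i | o j i) A i n ^ c i j) * (\prod_(i | o i j) A i n.+1 ^ c i j))%N.

Local Notation Z := exchange_product.

Hypothesis Arec : forall j n, (A j n * A j n.+1 = 1 + Z j n)%N.

Lemma frise_deterministic m n : (forall j, A j m = A j n) ->
  forall k j, A j (m + k)%N = A j (n + k)%N.
Proof.
move=> Amn; elim=> [|k IHk] j; first by rewrite !addn0.
rewrite !addnS; move: (m + k)%N (n + k)%N IHk => {Amn} m' n' Amn.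
apply: (acyclic_ind (P := fun j => A j m'.+1 = A j n'.+1) acyc) => {}j IHj.
apply/eqP; rewrite -(eqn_pmul2l (A_gt0 j m')) Arec Amn Arec /Z; apply/eqP.
by congr (1 + _ * _)%N; apply: eq_bigr => i oi; rewrite ?Amn ?IHj.
Qed.

Lemma frise_repeat_bounded m n : (m < n)%N -> (forall j, A j m = A j n) ->
  exists M, forall j k, (A j k <= M)%N.
Proof.
move=> ltmn Amn; exists (\sum_i \sum_(k < n) A i k)%N => j k.
elim/ltn_ind: k => k IHk; have [ltkn|lenk] := ltnP k n.
  rewrite (bigD1 j) //= (bigD1 (Ordinal ltkn)) //= -addnA; exact: leq_addr.
rewrite -(subnKC lenk) -(frise_deterministic Amn); apply: IHk; lia.
Qed.

Lemma frise_bounded_repeat M : (forall j n, A j n <= M)%N ->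
  exists m n, (m < n)%N /\ forall j, A j m = A j n.
Proof.
move=> AM; pose T := {ffun 'I_d -> 'I_M.+1}.
pose f (n : 'I_#|T|.+1) : T := [ffun j => inord (A j n)].
have /injectivePn[m [n nmn fmn]] : ~~ injectiveb f.
  by apply/injectiveP=> /leq_card; rewrite card_ord ltnn.
have Amn j : A j m = A j n.
  have := congr1 (fun g : T => g j : nat) fmn.
  by rewrite /= !ffunE !inordK // ltnS.
have [ltmn|ltnm|/val_inj eqmn] := ltngtP m n.
- by exists m, n.
- by exists n, m; split=> // j; rewrite Amn.
- by rewrite eqmn eqxx in nmn.
Qed.

(** The exchange relations are multiplied over one period. As [A j m = A j n], shifting the window
    leaves [P j] unchanged, so the left sides give [P j ^ 2]; dropping the summands 1 on the right
    makes the inequality strict. *)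
Lemma frise_repeat_subadditive m n : (m < n)%N -> (forall j, A j m = A j n) ->
  exists L : 'I_d -> nat, forall j, (\sum_i c i j * L i < 2 * L j)%N.
Proof.
move=> ltmn Amn; pose P j := (\prod_(m <= k < n) A j k)%N.
have P0 j : (0 < P j)%N by apply: prodn_gt0.
have shiftP j : (\prod_(m <= k < n) A j k.+1 = P j)%N.
  have lemn := ltnW ltmn; have recl := big_nat_recl n m (A j) lemn.
  have recr := big_nat_recr n m (A j) lemn.
  apply/eqP; rewrite -(eqn_pmul2l (A_gt0 j m)); apply/eqP.
  by rewrite {2}Amn [RHS]mulnC; apply: etrans (esym (recl _ _)) (recr _ _).
apply: (log_subadditive P0) => j.
have -> : (\prod_i P i ^ c i j = \prod_(m <= k < n) Z j k)%N.
  rewrite (@big_neighbours _ _ _ _ o j) //=; last first.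
    by move=> i oji oij; rewrite c_supp.
  rewrite big_split /=; congr (_ * _)%N; rewrite exchange_big /=.
    by apply: eq_bigr => i _; rewrite prod_expn.
  by apply: eq_bigr => i _; rewrite prod_expn shiftP.
have -> : (P j ^ 2 = \prod_(m <= k < n) (1 + Z j k))%N.
  rewrite -mulnn -{2}shiftP -big_split /=.
  by apply: eq_bigr => k _; rewrite Arec.
exact: ltn_prod_succ.
Qed.

(** Rounding each logarithm down costs a bounded error per term, hence O(N) in the sum, the order of
    error that the estimates tolerate. *)
Definition log_sum j N := (\sum_(k < N) trunc_log 2 (A j k))%N.

Local Notation b j n := (trunc_log 2 (A j n)).
Local Notation S := log_sum.

Let A_ge j n : (2 ^ b j n <= A j n)%N.
Proof. exact: trunc_logP. Qed.

Let A_lt j n : (A j n < 2 ^ (b j n).+1)%N.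
Proof. exact: trunc_log_ltn. Qed.

(** [X] is the logarithm of the exchange product computed from rounded values; [D] bounds the
    accumulated rounding error. *)
Let X j n := (\sum_(i | o j i) c i j * b i n + \sum_(i | o i j) c i j * b i n.+1)%N.
Let D j := (\sum_i c i j)%N.

Let ge_exchange_product j n : (2 ^ X j n <= Z j n)%N.
Proof.
rewrite /X expnD !expn_sum; apply: leq_mul; apply: leq_prod => i _;
by rewrite mulnC expnM leq_expn2r.
Qed.

Let le_exchange_product j n : (Z j n <= 2 ^ (X j n + D j))%N.
Proof.
have -> : (X j n + D j = \sum_(i | o j i) c i j * (b i n).+1 +
    \sum_(i | o i j) c i j * (b i n.+1).+1)%N.
  rewrite /D (@big_neighbours _ _ _ _ o j) //; last first.
    by move=> i; apply: c_supp.
  by rewrite addnACA -!big_split /=; congr (_ + _)%N;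
    apply: eq_bigr => i _; rewrite mulnSr.
rewrite expnD !expn_sum; apply: leq_mul; apply: leq_prod => i _;
by rewrite mulnC expnM leq_expn2r // ltnW.
Qed.

(** The two bounds come from [2^X <= Z < A_n A_{n+1} < 2^(b_n + b_{n+1} + 2)] and [2^(b_n + b_{n+1})
    <= 1 + Z <= 2 * 2^(X + D)]. *)
Let exchange_log j n :
  (X j n <= b j n + b j n.+1 + 1)%N /\ (b j n + b j n.+1 <= X j n + D j + 1)%N.
Proof.
split.
  rewrite -ltnS -(ltn_exp2l (m := 2)) //.
  apply: leq_ltn_trans (ge_exchange_product j n) _; rewrite -add1n -Arec.
  apply: leq_trans (leq_mul (ltnW (A_lt j n)) (ltnW (A_lt j n.+1))) _.
  by rewrite -expnD leq_exp2l //; lia.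
rewrite -(leq_exp2l (m := 2)) // expnD; apply: leq_trans (leq_mul (A_ge j n) (A_ge j n.+1)) _.
rewrite Arec [leqRHS]expnD expn1 muln2 -addnn leq_add ?expn_gt0 //.
Qed.

(** [exchange_log] is summed over [k < N]. Shifting time by one only adds end terms [b i N], as
    [A i 0 = 1] has logarithm 0, and these are at most [q (N + 1) <= 2 q N]. *)
Lemma log_sum_almost_null q : (forall j n, A j n <= 2 ^ (q * n.+1))%N ->
  exists2 K, (0 < K)%N & forall N j, (0 < N)%N ->
    (\sum_i c i j * S i N <= 2 * S j N + K * N)%N /\
    (2 * S j N <= \sum_i c i j * S i N + K * N)%N.
Proof.
move=> Aq; pose DD := (\sum_j D j)%N.
exists ((DD + 1) * (2 * q + 1))%N => [|N j N0]; first by rewrite muln_gt0 !addn1.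
have leD : (D j <= DD)%N by rewrite /DD (bigD1 j) //= leq_addr.
have bq i : (b i N <= 2 * q * N)%N.
  have : (2 ^ b i N <= 2 ^ (q * N.+1))%N.
    by apply: leq_trans (Aq i N).
  rewrite leq_exp2l //; nia.
have shiftS i : (\sum_(k < N) b i k.+1 = S i N + b i N)%N.
  have recl := @big_ord_recl _ 0%N addn N (fun k => b i k).
  have recr := @big_ord_recr _ 0%N addn N (fun k => b i k).
  by move: recl; rewrite recr /= A0 trunc_log1 add0n.
have sumX : (\sum_(k < N) X j k =
    \sum_i c i j * S i N + \sum_(i | o i j) c i j * b i N)%N.
  rewrite big_split /= (@big_neighbours _ _ _ _ o j) //; last first.
    by move=> i oji oij; rewrite c_supp.
  rewrite -addnA -[in RHS]big_split /=; congr (_ + _)%N; rewrite exchange_big /=.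
    by apply: eq_bigr => i _; rewrite -big_distrr.
  by apply: eq_bigr => i _; rewrite -mulnDr -shiftS big_distrr.
have sumb : (\sum_(k < N) (b j k + b j k.+1) = 2 * S j N + b j N)%N.
  by rewrite big_split /= shiftS addnA addnn mul2n.
have lo : (\sum_(k < N) X j k <= 2 * S j N + b j N + N)%N.
  rewrite -sumb -[N in (_ + N)%N]card_ord -sum1_card -big_split /=.
  by apply: leq_sum => k _; case: (exchange_log j k).
have hi : (2 * S j N + b j N <= \sum_(k < N) X j k + (D j + 1) * N)%N.
  rewrite -sumb -[N in (_ * N)%N]card_ord mulnC -sum_nat_const -big_split /=.
  by apply: leq_sum => k _; rewrite addnA; case: (exchange_log j k).
have bnd : (\sum_(i | o i j) c i j * b i N <= D j * (2 * q * N))%N.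
  apply: (@leq_trans (\sum_(i | o i j) c i j * (2 * q * N))).
    by apply: leq_sum => i _; rewrite leq_mul2l bq orbT.
  rewrite -big_distrl leq_mul2r /D [X in (_ <= X)%N](bigID (fun i => o i j)) /=.
  by rewrite leq_addr orbT.
have bjq := bq j; move: lo hi; rewrite sumX; nia.
Qed.

Lemma log_sum_superlinear :
  (forall m n, (forall j, A j m = A j n) -> m = n) ->
  forall t, exists N, (0 < N)%N /\ exists j, (t * N <= S j N)%N.
Proof.
move=> Ainj t; have d0 : (0 < d)%N.
  rewrite lt0n; apply/eqP=> dz; suff : 0%N = 1%N by [].
  by apply: Ainj => j; have := leq_ltn_trans (leq0n j) (ltn_ord j); lia.
(* At most [c0] distinct vectors have all entries below [M], so at least [c0] of the first [N] times
   have an entry [>= 2^u]. The total is then at least [u * c0 = d * (t * N)], and some [j] has its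
   share [t * N]. *)
pose u := (2 * t * d)%N; pose M := (2 ^ u)%N; pose c0 := (M ^ d)%N.
have M0 : (0 < M)%N by rewrite expn_gt0.
have c00 : (0 < c0)%N by rewrite expn_gt0 M0.
pose N := (2 * c0)%N; exists N; split; first by rewrite muln_gt0.
pose small (k : 'I_N) := [forall j, A j k < M]%N.
have card_small : (#|small| <= c0)%N.
  pose f (k : 'I_N) : {ffun 'I_d -> 'I_M.-1.+1} := [ffun j => inord (A j k)].
  have finj : {in small &, injective f}.
    move=> m n /forallP sm /forallP sn fmn; apply/val_inj/Ainj => j.
    have := congr1 (fun g : {ffun 'I_d -> 'I_M.-1.+1} => g j : nat) fmn.
    by rewrite /= !ffunE !inordK // prednK.
  have := max_card (mem (f @: small)).
  by rewrite (card_in_imset finj) card_ffun !card_ord prednK.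
have big_total : (u * c0 <= \sum_j S j N)%N.
  rewrite exchange_big /=.
  apply: (@leq_trans (\sum_(k < N | ~~ small k) u)%N).
    rewrite sum_nat_const mulnC leq_mul2r; apply/orP; right.
    have := cardC small; rewrite card_ord => cN.
    rewrite (eq_card (B := [predC small])) //.
    by rewrite -(leq_add2l #|small|) cN [leqRHS]mul2n -addnn leq_add2r.
  rewrite [leqRHS](bigID small) /=; apply: leq_trans (leq_addl _ _).
  apply: leq_sum => k; rewrite negb_forall => /existsP[j]; rewrite -leqNgt => Mj.
  rewrite (bigD1 j) //=; apply: leq_trans (leq_addr _ _).
  by rewrite trunc_log_max.
apply/existsP; apply: contraLR big_total; rewrite negb_exists => /forallP lt_S.
have : (\sum_(j < d) (S j N + 1) <= \sum_(j < d) t * N)%N.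
  by apply: leq_sum => j _; rewrite addn1 ltnNge lt_S.
rewrite big_split /= sum1_card sum_nat_const card_ord /u /N; nia.
Qed.

End NaturalFrise.

(** * Boundedness and type *)

(** The diagonal is set to zero so that sums over all [i] see only the neighbours of [j]. *)
Definition offdiag_weight (d : nat) (C : 'M[int]_d) (i j : 'I_d) : nat :=
  if i == j then 0%N else `|C i j|%N.

Lemma cartan_rat_offdiag (d : nat) (C : 'M[int]_d) i j : is_cartan C -> i != j ->
  cartan_rat C i j = - (offdiag_weight C i j)%:R.
Proof.
move=> [_ [Coff _]] nij; rewrite mxE /offdiag_weight (negPf nij).
by rewrite natr_absz ler0_norm ?Coff // mulrNz opprK.
Qed.

Lemma mulmx_cartan_rat (d : nat) (C : 'M[int]_d) (L : 'I_d -> nat) j :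
  is_cartan C -> ((\row_i (L i)%:R) *m cartan_rat C) 0 j =
  (2 * L j)%:R - (\sum_i offdiag_weight C i j * L i)%:R.
Proof.
move=> CC; rewrite mxE (bigD1 j) //= [in RHS](bigD1 j) //=.
rewrite {1}/offdiag_weight eqxx mul0n add0n natr_sum -sumrN.
congr (_ + _); first by rewrite !mxE natrM mulrC; case: CC => ->.
apply: eq_bigr => i nij; rewrite cartan_rat_offdiag // mxE natrM.
by rewrite mulrN mulrC.
Qed.

Lemma frise_natural (d : nat) (C : 'M[int]_d) o a A :
  is_orientation C o -> is_frise C o a ->
  (forall j n, a j n = (A j n)%:R) ->
  [/\ forall j, A j 0%N = 1%N,
      forall i j, ~~ (o i j && o j i),
      forall i j, ~~ o j i -> ~~ o i j -> offdiag_weight C i j = 0%N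
    & forall j n, (A j n * A j n.+1 =
        1 + exchange_product (offdiag_weight C) o A j n)%N].
Proof.
move=> [sub ori] [a0 arec] aA.
have wE i j : o i j || o j i ->
    offdiag_weight C i j = `|C i j|%N /\ offdiag_weight C j i = `|C j i|%N.
  rewrite /offdiag_weight (eq_sym j) => oij.
  suff /negPf-> : i != j by [].
  by case/orP: oij => /sub/andP[] //; rewrite eq_sym.
split=> [j|i j|i j oji oij|j n].
- by apply/eqP; rewrite -(eqr_nat rat) -aA a0.
- by apply/negP=> /andP[oij oji]; have /ori := sub _ _ oij; rewrite oij oji.
- rewrite /offdiag_weight; have [//|nij] := eqVneq i j.
  apply/eqP; rewrite absz_eq0; apply/negPn/negP=> Cij.
  have /ori : cartan_graph C i j by rewrite /cartan_graph nij.
  by rewrite (negPf oij) (negPf oji).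
- apply/eqP; rewrite -(eqr_nat rat) natrM -!aA arec natrD natrM !natr_prod.
  apply/eqP; congr (1 + _ * _); apply: eq_bigr => i oi; rewrite natrX -aA.
    by have [|_ ->] := wE j i; rewrite ?oi.
  by have [|-> _] := wE i j; rewrite ?oi.
Qed.

Theorem theorem1 (F : numClosedFieldType) (d : nat) (C : 'M[int]_d)
  (o : rel 'I_d) (a : 'I_d -> nat -> rat) :
  is_cartan C -> cartan_connected C -> is_orientation C o -> acyclic o ->
  is_frise C o a ->
  (forall j, has_linear_recurrence (fun n => (ratr (a j n) : F))) ->
  ((exists M : rat, forall j n, `|a j n| <= M) -> finite_type C) /\
  (~ (exists M : rat, forall j n, `|a j n| <= M) -> affine_type C).
Proof.
move=> CC Cconn ori acyc frA lin.
have [A [A_gt0 aA]] := frise_integral CC ori acyc frA.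
have [A0 asym supp Arec] := frise_natural ori frA aA.
have norma j n : `|a j n| = (A j n)%:R by rewrite aA normr_nat.
have Aoff i j : i != j -> cartan_rat C i j <= 0.
  by move=> nij; rewrite cartan_rat_offdiag // oppr_le0 ler0n.
have Adiag i : 0 <= cartan_rat C i i by rewrite mxE; case: CC => ->.
have Airr i j : connect [rel i j | (i != j) && (cartan_rat C i j != 0)] i j.
  rewrite (eq_connect (e' := cartan_graph C)) // => {}i {}j /=.
  by rewrite mxE intr_eq0.
split=> [[M aM]|unbounded].
  have [|m [n [ltmn Amn]]] := frise_bounded_repeat (A := A) (M := Num.bound M).
    move=> j n; rewrite -(ler_nat rat) -norma; apply: le_trans (aM j n) _.
    apply/ltW/archi_boundP; exact: le_trans (aM j n).
  have [L LP] := frise_repeat_subadditive asym supp A_gt0 Arec ltmn Amn.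
  have [||? ? ?] := pairing_gt0_finite Aoff Airr (V := \row_i (L i)%:R).
  - by move=> i; rewrite mxE ler0n.
  - by move=> j; rewrite mulmx_cartan_rat // subr_gt0 ltr_nat.
  - by split.
have Ainj m n : (forall j, A j m = A j n) -> m = n.
  wlog ltmn : m n / (m < n)%N => [IH|] Amn.
    by have [/IH->|/IH->|] := ltngtP m n => // j; rewrite Amn.
  case: unbounded.
  have [M AM] := frise_repeat_bounded acyc A_gt0 Arec ltmn Amn.
  by exists M%:R => j k; rewrite norma ler_nat.
have [B AB] : exists B : 'I_d -> nat, forall j n, (A j n <= B j ^ n.+1)%N.
  apply: (fin_all_exists (P := fun j B => forall n, A j n <= B ^ n.+1)%N) => j.
  have [B aB] := linear_recurrence_le_exp
    (linear_recurrence_descent (f := ratr : {rmorphism rat -> F}) (lin j)).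
  by exists B => n; rewrite -(ler_nat rat) -norma.
(* One exponent serves all vertices, since [B j <= q < 2^q]. *)
pose q := (\sum_j B j)%N.
have Aq j n : (A j n <= 2 ^ (q * n.+1))%N.
  rewrite expnM; apply: leq_trans (AB j n) _; apply: leq_expn2r.
  apply: leq_trans (ltnW (ltn_expl q (ltnSn 1))).
  by rewrite /q (bigD1 j) //= leq_addr.
have [K K0 KP] := log_sum_almost_null asym supp A0 A_gt0 Arec Aq.
have [|rk ker sup] := almost_null_affine Aoff Adiag Airr; last by split.
(* The factor [K] compensates the rescaling by [1 / (K N)], which brings the bound [K N] on the
   entries of [S C] down to 1. *)
move=> t; have [N [N0 [i tN]]] := log_sum_superlinear Ainj (Num.bound `|t| * K).
have KN0 : 0 < (K * N)%:R :> rat by rewrite ltr0n muln_gt0 K0.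
exists ((K * N)%:R^-1 *: \row_i (log_sum A i N)%:R); split=> [k|j|].
- by rewrite !mxE mulr_ge0 ?invr_ge0 ?ler0n.
- rewrite -scalemxAl mxE normrM mulmx_cartan_rat // ger0_norm ?invr_ge0 ?ler0n //.
  rewrite mulrC ler_pdivrMr // mul1r ler_distl; have [lo hi] := KP N j N0.
  by rewrite lerBlDr -!natrD !ler_nat lo hi.
- exists i; rewrite !mxE mulrC ler_pdivlMr //.
  apply: (@le_trans _ _ (Num.bound `|t| * K * N)%:R); last by rewrite ler_nat.
  rewrite -mulnA [leRHS]natrM ler_wpM2r ?ltW //.
  exact: le_lt_trans (ler_norm t) (archi_boundP (normr_ge0 t)).
Qed.
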